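(* For each integer $k\ge 1$ let $\mathcal{T}=\mathcal{T}^{(k)}$ be the finite tree and $N=N^{(k)}=n_k^3$ the integer defined in the context, and let $t_{\mathrm{rel}}=t_{\mathrm{rel}}^{(k)}$ be the relaxation time of the lazy simple random walk on $\mathcal{T}^{(k)}$. Then $$t_{\mathrm{rel}}\asymp N,$$ i.e. there is a constant $C>0$ such that $C^{-1}N^{(k)}\le t_{\mathrm{rel}}^{(k)}\le C N^{(k)}$ for all $k$.
   Context: Tree. Let $n_j=2^{2^j}$ for integers $j\ge 0$, fix $k\ge 1$, and put $N=n_k^3$; $[k/2]$ is the integer part of $k/2$. The tree $\mathcal{T}=\mathcal{T}^{(k)}$ is built from the path (segment) with vertices $0,1,\dots,n_k$ and edges $\{i,i+1\}$ as follows. A binary tree $\mathcal{T}_0$ with $N$ vertices is attached at the vertex $0$, its root being identified with $0$. For each $j\in\{[k/2],\dots,k\}$ a binary tree $\mathcal{T}_j$ with $N/n_j$ vertices is attached at the vertex $n_j$, its root being identified with $n_j$. The attached trees are otherwise disjoint from the path and from each other. Here a binary tree with $m$ vertices is the balanced rooted binary tree with exactly $m$ vertices: for every level except possibly the last, level $i$ contains $2^i$ vertices, and the remaining vertices are on the last level, filled from the left. Lazy simple random walk. If $P$ is the transition matrix of simple random walk on $\mathcal{T}$ (from each vertex jump to a uniformly chosen neighbour), the lazy simple random walk is the discrete-time Markov chain with transition matrix $(P+I)/2$. Relaxation time. If $1=\lambda_1\ge\lambda_2\ge\lambda_3\ge\cdots$ are the eigenvalues of the transition matrix of a finite (reversible)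 chain and $\lambda_*=\max_{i\ge 2}|\lambda_i|$, then $t_{\mathrm{rel}}=(1-\lambda_* )^{-1}$. (For a lazy chain $\lambda_*=\lambda_2$.) *)

(* Defs.v *)
From HB Require Import structures.
From mathcomp Require Import all_boot all_order all_algebra.
From mathcomp Require Import boolp classical_sets reals.

Set Implicit Arguments.
Unset Strict Implicit.
Unset Printing Implicit Defensive.

Import Order.TTheory GRing.Theory Num.Theory.

Local Open Scope ring_scope.

Section Spectrum.
Variable R : realType.

(* Eigenvalues with algebraic multiplicity, in nonincreasing order.  At most one
   sequence qualifies; one exists iff the characteristic polynomial splits over
   the reals, which is the case for transition matrices of reversible chains.
   The default [::] is a junk value for the other matrices. *)
Definition eigenvalues (m : nat) (A : 'M[R]_m) : seq R :=
  xget [::] [set s : seq R |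
    sorted >=%R s /\ char_poly A = \prod_(l <- s) ('X - l%:P)]%classic.

(* [behead] drops lambda_1; 0 is neutral for the maximum of absolute values. *)
Definition lambda_star (m : nat) (A : 'M[R]_m) : R :=
  \big[Num.max/0]_(l <- behead (eigenvalues A)) `|l|.

Definition relaxation_time (m : nat) (A : 'M[R]_m) : R :=
  (1 - lambda_star A)^-1.

End Spectrum.

Section RandomWalk.
Variables (R : realType) (V : finType) (adj : rel V).

Definition degree (x : V) : nat := #|[pred y | adj x y]|.

Definition srw_mx : 'M[R]_#|V| :=
  \matrix_(i, j) (if adj (enum_val i) (enum_val j)
                  then (degree (enum_val i))%:R^-1 else 0).

Definition lazy_srw_mx : 'M[R]_#|V| := 2^-1 *: (srw_mx + 1%:M).

End RandomWalk.

Local Open Scope nat_scope.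

Definition scale (j : nat) : nat := 2 ^ (2 ^ j).

Definition bigN (k : nat) : nat := scale k ^ 3.

(* The balanced binary tree with m vertices has vertex set {0, ..., m-1},
   numbered level by level and from left to right, so that 0 is the root and the
   children of a are those of 2a+1, 2a+2 that are smaller than m. *)
Definition bintree_child (a b : nat) : bool := (b == a.*2.+1) || (b == a.*2.+2).

Definition bintree_adj (a b : nat) : bool :=
  bintree_child a b || bintree_child b a.

(* Number of vertices of the binary tree rooted at the path vertex i, the path
   vertices without an attached tree being given a one-vertex tree. *)
Definition bush_size (k i : nat) : nat :=
  if i == 0 then bigN k
  else if [exists j : 'I_k.+1, (k./2 <= j) && (i == scale j)] then bigN k %/ i
  else 1.

(* The vertex (i, a) is the a-th vertex of the binary tree rooted at i; the path
   vertex i is identified with the root (i, 0). *)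
Definition vertex (k : nat) : finType :=
  {i : 'I_(scale k).+1 & 'I_(bush_size k i)}.

Definition tree_adj (k : nat) : rel (vertex k) := fun x y =>
  let i : nat := tag x in let a : nat := tagged x in
  let i' : nat := tag y in let b : nat := tagged y in
  ((i == i') && bintree_adj a b)
  || [&& a == 0, b == 0 & (i' == i.+1) || (i == i'.+1)].

Definition t_rel (R : realType) (k : nat) : R :=
  relaxation_time (lazy_srw_mx R (@tree_adj k)).

(* Main.v *)
Require Import Defs.
From mathcomp Require Import all_boot all_order all_algebra.
From mathcomp Require Import spectral complex boolp classical_sets reals.
From mathcomp Require Import ring lra zify.

Set Implicit Arguments.
Unset Strict Implicit.
Unset Printing Implicit Defensive.

Import Order.TTheory GRing.Theory Num.Theory.

Local Open Scope ring_scope.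

(** The relaxation time is the inverse of the spectral gap, and by
    Courant-Fischer the gap compares the Dirichlet energy of a function with its
    mass [sum_x deg(x) f(x)^2].

    Upper bound: it suffices that every [f] vanishing at the root has mass at most
    [O(N)] times its energy, since these functions form a space of codimension
    one.  As degrees are bounded, only [sum_x f(x)^2] matters, and it is
    split into the deviation of [f] from its value at the root of each bush, and
    the values on the path weighted by the bush sizes.
    - In a binary tree the number of vertices doubles from one level to the next,
      so that an edge at depth [i] need only count with weight of order [2^i] in
      the estimate of [f(x) - f(root)], by Cauchy-Schwarz with weights whose
      inverses are summable.  There are [m / 2^i] vertices below it, hence the
      deviation is at most [4 m <= 4 N] times the energy ([heap_poincare]).
    - At distance [n_j] a bush has [N / n_j] vertices and the resistance to the
      root is [n_j].  Each scale thus contributes [O(N)] times the energy, and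
      because the [n_j] grow at least geometrically the contributions of all the
      scales together are still [O(N)] ([path_hardy]); without this the number of
      scales would appear as a factor.

    Lower bound: the two subtrees below the root of the bush at [0] contain at
    least [N / 4] vertices each and are both attached by a single edge.  The span
    of their indicators is a plane on which the energy is at most [O(1 / N)] times
    the mass ([cut_energy], [cut_mass]), so the second eigenvalue is at least
    [1 - 2 / N].

    The eigenvalues are read off the characteristic polynomial, so the
    variational characterization needs an orthogonal diagonalization over the
    reals: [symmetric_diagonalization], transported to reversible matrices by
    [reversible_diagonalization]. *)

(** * The real spectral theorem *)

Lemma char_poly_conj (F : fieldType) n (V A D : 'M[F]_n) :
  V \in unitmx -> V *m A = D *m V -> char_poly A = char_poly D.
Proof.
move=> Vu VA; pose W := map_mx polyC V.
have Wu : \det W \is a GRing.unit.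
  by rewrite det_map_mx; apply: rmorph_unit; rewrite -unitmxE.
apply: (mulrI Wu); rewrite [RHS]mulrC /char_poly -!det_mulmx.
congr (\det _); rewrite /char_poly_mx mulmxBl mulmxBr.
by rewrite -!map_mxM VA scalar_mxC.
Qed.

(** The complexified matrix is Hermitian, hence unitarily diagonalizable with
    a real diagonal, and the roots of its characteristic polynomial are already
    roots over the reals. *)
Lemma symmetric_eigenvalue_ex (R : realType) n (B : 'M[R]_n.+1) :
  B^T = B -> exists a, eigenvalue B a.
Proof.
move=> Bs; pose BC := map_mx (real_complex R) B.
have Bh : BC \is hermsymmx.
  apply: realsym_hermsym.
    apply/is_hermitianmxP; rewrite expr0 scale1r map_mx_id // /BC.
    by apply/matrixP => i j; rewrite !mxE -{1}Bs mxE.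
  by apply/mxOverP => i j; rewrite mxE; apply/complex_realP; exists (B i j).
have [a Da] : exists a, spectral_diag BC 0 0 = real_complex R a.
  by apply/complex_realP; have /mxOverP := hermitian_spectral_diag_real Bh.
exists a; rewrite eigenvalue_root_char.
rewrite -(fmorph_root (real_complex R)) map_char_poly -/BC.
have /hermitian_normalmx/orthomx_spectralP BE := Bh.
have Uu := spectral_unit BC.
rewrite (@char_poly_conj _ _ (spectralmx BC) _ (diag_mx (spectral_diag BC))) //.
  rewrite char_poly_trig ?diag_mx_is_trig // big_ord_recl rootM mxE eqxx mulr1n Da.
  by rewrite root_XsubC eqxx.
by rewrite [X in _ *m X]BE mulmxA mulKVmx.
Qed.

(** A Householder reflection along the difference of the two vectors.  It serves
    for deflation: if [u] is an eigenvector of a symmetric [B], then [H B H]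
    splits into blocks. *)
Lemma householder (R : rcfType) n (u : 'rV[R]_n.+1) :
  u *m u^T = 1%:M -> exists H : 'M[R]_n.+1,
  [/\ H^T = H, H *m H = 1%:M & delta_mx 0 0 *m H = u].
Proof.
move=> u1; set e : 'rV[R]_n.+1 := delta_mx 0 0.
have e1 : e *m e^T = 1%:M.
  by rewrite /e trmx_delta mul_delta_mx; apply/matrixP => i j; rewrite !ord1 !mxE.
pose t := u 0 0.
have eu : e *m u^T = t%:M.
  by apply/matrixP => i j; rewrite !ord1 -rowE !mxE eqxx.
have ue : u *m e^T = t%:M.
  by rewrite -[LHS]trmxK trmx_mul trmxK eu tr_scalar_mx.
have [v vE] : exists v, v = e - u by exists (e - u).
pose c := (1 - t)^-1.
have vv : v *m v^T = (2 * (1 - t))%:M.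
  rewrite vE linearB /= mulmxBl !mulmxBr e1 eu ue u1.
  by apply/matrixP => i j; rewrite !ord1 !mxE !mulr1n; ring.
have ev : e *m v^T = (1 - t)%:M.
  by rewrite vE linearB /= mulmxBr e1 eu; apply/matrixP=> i j; rewrite !ord1 !mxE.
(* If [t = 1] then [v = 0], and the junk value of [c] does no harm. *)
have ct : (1 - t) *: (c *: v) = v.
  have [t1|t1] := eqVneq t 1; last first.
    by rewrite scalerA divff ?scale1r // subr_eq0 eq_sym.
  suff -> : v = 0 by rewrite !scaler0.
  have /matrixP/(_ 0 0) := vv; rewrite t1 subrr mulr0 !mxE mul0rn => /eqP.
  rewrite psumr_eq0 => [/allP v0|i _]; last by rewrite [v^T _ _]mxE -expr2 sqr_ge0.
  apply/matrixP => i j; rewrite ord1 [RHS]mxE.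
  have /implyP/(_ isT) := v0 j (mem_index_enum _).
  by rewrite [v^T _ _]mxE -expr2 sqrf_eq0 => /eqP.
exists (1%:M - v^T *m (c *: v)); split.
- by rewrite linearB /= trmx1 trmx_mul trmxK linearZ /= -scalemxAl -scalemxAr.
- have cK : (1 - t) *: (c *: (v^T *m v)) = v^T *m v by rewrite 2!scalemxAr ct.
  rewrite -scalemxAr mulmxBl !mulmxBr !mul1mx mulmx1 -!scalemxAl -!scalemxAr.
  have -> : v^T *m v *m (v^T *m v) = (2 * (1 - t)) *: (v^T *m v).
    by rewrite mulmxA -[v^T *m v *m v^T]mulmxA vv mul_mx_scalar -scalemxAl.
  have -> : c *: ((2 * (1 - t)) *: (v^T *m v)) = 2 *: (v^T *m v).
    by rewrite -[in RHS]cK !scalerA; congr (_ *: _); ring.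
  rewrite scalerA mulrC -scalerA scaler_nat mulr2n.
  by rewrite opprB addrK subrK.
- by rewrite mulmxBr mulmx1 mulmxA ev mul_scalar_mx ct vE opprB addrC subrK.
Qed.

(** Induction on the size: conjugating by a Householder reflection that sends
    the first basis vector to a unit eigenvector clears the first row, hence by
    symmetry the first column. *)
Lemma symmetric_diagonalization (R : realType) n (B : 'M[R]_n) :
  B^T = B -> exists P (d : 'rV[R]_n), P *m P^T = 1%:M /\ P *m B = diag_mx d *m P.
Proof.
elim: n B => [|n IHn] B Bs.
  by exists 1%:M, 0; split; apply/matrixP => -[].
have [a /eigenvalueP[w wB w0]] := symmetric_eigenvalue_ex Bs.
have ww : 0 < (w *m w^T) 0 0.
  rewrite mxE lt_neqAle eq_sym psumr_eq0 => [|i _]; last first.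
    by rewrite [w^T _ _]mxE -expr2 sqr_ge0.
  rewrite sumr_ge0 ?andbT => [|i _]; last by rewrite [w^T _ _]mxE -expr2 sqr_ge0.
  apply: contraNN w0 => /allP w0; apply/eqP/matrixP => i j.
  rewrite ord1 [RHS]mxE; have /implyP/(_ isT) := w0 j (mem_index_enum _).
  by rewrite [w^T _ _]mxE -expr2 sqrf_eq0 => /eqP.
pose r := Num.sqrt ((w *m w^T) 0 0); pose u := r^-1 *: w.
have r0 : r != 0 by rewrite gt_eqF ?sqrtr_gt0.
have u1 : u *m u^T = 1%:M.
  rewrite linearZ /= -scalemxAl -scalemxAr scalerA.
  apply/matrixP => i j; rewrite !ord1 mxE -[(w *m _) _ _]sqr_sqrtr ?ltW // -/r mxE.
  by rewrite eqxx mulr1n; field.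
have uB : u *m B = a *: u by rewrite -scalemxAl wB scalerA mulrC -scalerA.
have [H [Hs HH Hu]] := householder u1.
pose G : 'M[R]_(1 + n) := H *m B *m H.
have Gs : G^T = G by rewrite /G !trmx_mul Hs Bs mulmxA.
have G0 : usubmx G = row_mx a%:M 0.
  have -> : usubmx G = delta_mx 0 0 *m G.
    apply/matrixP => i j; rewrite -rowE !mxE ord1.
    by rewrite (_ : lshift n 0 = 0) //; apply: val_inj.
  rewrite /G !mulmxA Hu uB -scalemxAl -Hu -mulmxA HH mulmx1.
  apply/matrixP => i j; rewrite ord1 -[j]splitK; case: (split j) => j' /=.
    by rewrite row_mxEl ord1 !mxE !eqxx mulr1.
  by rewrite row_mxEr !mxE mulr0.
have BE : H *m G *m H = B by rewrite /G !mulmxA HH mul1mx -mulmxA HH mulmx1.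
clearbody G.
have GE : G = block_mx a%:M 0 0 (drsubmx G).
  rewrite -[LHS]submxK; congr block_mx.
  - by rewrite /ulsubmx G0 row_mxKl.
  - by rewrite /ursubmx G0 row_mxKr.
  - by rewrite -[LHS]trmxK trmx_dlsub Gs /ursubmx G0 row_mxKr trmx0.
have [|P [d [P1 PB]]] := IHn (drsubmx G).
  by rewrite -[in RHS]Gs trmx_drsub.
exists ((block_mx 1%:M 0 0 P : 'M[R]_(1 + n)) *m H), (row_mx a%:M d : 'rV_(1 + n)).
split.
  rewrite trmx_mul Hs mulmxA -[_ *m H *m H]mulmxA HH mulmx1.
  rewrite (@tr_block_mx _ 1 n 1 n) !trmx0 trmx1 (@mulmx_block _ 1 n 1 n 1 n).
  rewrite !mul0mx !mulmx0 mulmx1 !addr0 !add0r P1.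
  by rewrite -(scalar_mx_block 1 n).
have -> : diag_mx (row_mx a%:M d : 'rV_(1 + n)) = block_mx a%:M 0 0 (diag_mx d).
  by rewrite diag_mx_row; congr block_mx; apply/matrixP => i j; rewrite !ord1 !mxE.
rewrite -BE !mulmxA -[_ *m H *m H]mulmxA HH mulmx1 GE (@mulmx_block _ 1 n 1 n 1 n).
by rewrite (@mulmx_block _ 1 n 1 n 1 n) !mul0mx !mulmx0 mulmx1 mul1mx !addr0 !add0r PB.
Qed.

(** * Second eigenvalue of a reversible matrix *)

Definition wnorm (R : realType) n (w : 'I_n -> R) (f : 'rV[R]_n) : R :=
  \sum_i w i * f 0 i ^+ 2.

Definition wform (R : realType) n (w : 'I_n -> R) (A : 'M[R]_n) (f : 'rV[R]_n) : R :=
  \sum_i \sum_j w i * A i j * f 0 i * f 0 j.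

Lemma wform_diag (R : realType) n (d f : 'rV[R]_n) :
  (f *m diag_mx d *m f^T) 0 0 = \sum_i d 0 i * f 0 i ^+ 2.
Proof.
rewrite mxE; apply: eq_bigr => j _.
by rewrite mul_mx_diag !mxE; ring.
Qed.

(** Reversibility says that [diag(w)^(1/2) A diag(w)^(-1/2)] is symmetric; an
    orthogonal diagonalization of that matrix provides coordinates [f *m Q] in
    which the weighted norm and the form of [A] are simultaneously diagonal. *)
Lemma reversible_diagonalization (R : realType) n (A : 'M[R]_n) (w : 'I_n -> R) :
  (forall i, 0 < w i) -> (forall i j, w i * A i j = w j * A j i) ->
  exists (Q : 'M[R]_n) (d : 'rV[R]_n),
  [/\ Q \in unitmx, char_poly A = \prod_i ('X - (d 0 i)%:P),
      forall f, wnorm w f = \sum_i (f *m Q) 0 i ^+ 2 &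
      forall f, wform w A f = \sum_i d 0 i * (f *m Q) 0 i ^+ 2].
Proof.
move=> w0 wA; pose s i := Num.sqrt (w i).
have s0 i : s i != 0 by rewrite gt_eqF ?sqrtr_gt0.
have s2 i : w i = s i ^+ 2 by rewrite sqr_sqrtr // ltW.
pose S := diag_mx (\row_i s i); pose S' := diag_mx (\row_i (s i)^-1).
have SS' : S *m S' = 1%:M.
  by rewrite mulmx_diag; apply/matrixP => i j; rewrite !mxE divff.
have S'S : S' *m S = 1%:M by rewrite diag_mxC.
pose B := S *m A *m S'.
have Bs : B^T = B.
  apply/matrixP => i j; rewrite mxE /B !mul_mx_diag !mul_diag_mx !mxE.
  have := wA i j; rewrite !s2 => wij.
  apply: (mulfI (s0 i)); apply: (mulIf (s0 j)).
  transitivity (s j ^+ 2 * A j i); first by field.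
  by rewrite -wij; field.
have [P [d [P1 PB]]] := symmetric_diagonalization Bs.
have P2 : P^T *m P = 1%:M by apply: mulmx1C.
exists (S *m P^T), d; split.
- rewrite unitmx_mul unitmx_tr.
  by case/mulmx1_unit: P1 => -> _; case/mulmx1_unit: SS' => -> _.
- rewrite (@char_poly_conj _ _ (P *m S) _ (diag_mx d)).
  + rewrite char_poly_trig ?diag_mx_is_trig //; apply: eq_bigr => i _.
    by rewrite mxE eqxx mulr1n.
  + by rewrite unitmx_mul; case/mulmx1_unit: P1 => -> _; case/mulmx1_unit: SS' => -> _.
  + by rewrite mulmxA -PB /B -[RHS]mulmxA -[in RHS](mulmxA (S *m A)) S'S mulmx1 mulmxA.
- move=> f; transitivity ((f *m (S *m P^T) *m (f *m (S *m P^T))^T) 0 0); last first.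
    by rewrite mxE; apply: eq_bigr => i _; rewrite [X in _ * X]mxE expr2.
  rewrite !trmx_mul trmxK tr_diag_mx !mulmxA -[_ *m P^T *m P]mulmxA P2 mulmx1.
  rewrite mxE; apply: eq_bigr => i _.
  by rewrite !mul_mx_diag ![in RHS]mxE s2; ring.
- move=> f; rewrite -wform_diag !trmx_mul trmxK tr_diag_mx !mulmxA.
  rewrite -[_ *m diag_mx d *m P]mulmxA -PB /B !mulmxA.
  rewrite -[_ *m P^T *m P]mulmxA P2 mulmx1 -[_ *m S' *m S]mulmxA S'S mulmx1.
  rewrite mxE /wform exchange_big; apply: eq_bigr => j _; rewrite mxE mulr_suml.
  by apply: eq_bigr => i _; rewrite !mul_mx_diag ![in RHS]mxE s2; ring.
Qed.

(** The sorted list of eigenvalues is a rearrangement of any diagonal form, so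
    dropping its head removes one largest diagonal entry, with multiplicity one. *)
Lemma lambda_starE (R : realType) n (A : 'M[R]_n.+1) (d : 'I_n.+1 -> R) :
  char_poly A = \prod_i ('X - (d i)%:P) ->
  exists i0, (forall i, d i <= d i0) /\
    lambda_star A = \big[Num.max/0]_(i | i != i0) `|d i|.
Proof.
move=> Ad; rewrite /lambda_star.
have [] : sorted >=%R (eigenvalues A) /\
    char_poly A = \prod_(l <- eigenvalues A) ('X - l%:P).
  apply: (@xgetPex _ [::] [set s : seq R |
    sorted >=%R s /\ char_poly A = \prod_(l <- s) ('X - l%:P)]%classic).
  exists (sort >=%R [seq d i | i <- index_enum 'I_n.+1]); split.
    by apply: sort_sorted => x y; apply: le_total.
  by rewrite Ad (perm_big _ (permEl (perm_sort _ _))) big_map.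
move: (eigenvalues A) => e e_sorted; rewrite {}Ad => eE.
have {eE} : perm_eq e [seq d i | i <- index_enum 'I_n.+1].
  by apply: prod_XsubC_eq; rewrite -eE big_map.
case: e e_sorted => [|l e] e_sorted e_perm.
  by have := perm_size e_perm; rewrite size_map /index_enum -enumT size_enum_ord.
have /mapP[i0 _ lE] : l \in [seq d i | i <- index_enum 'I_n.+1].
  by rewrite -(perm_mem e_perm) mem_head.
exists i0; split=> [i|].
  have : d i \in l :: e by rewrite (perm_mem e_perm) map_f ?mem_index_enum.
  rewrite -lE inE => /predU1P[->//|]; apply/allP: (d i).
  by apply: order_path_min e_sorted => x y z /[swap]; apply: le_trans.
have e_perm' : perm_eq e [seq d i | i <- rem i0 (index_enum 'I_n.+1)].
  rewrite -(perm_cons l) (perm_trans e_perm) // lE -map_cons perm_map //.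
  by rewrite perm_to_rem ?mem_index_enum.
rewrite /= (perm_big _ e_perm') big_map rem_filter ?index_enum_uniq //.
by rewrite big_filter.
Qed.

(** Courant and Fischer: vanishing at [r] is one linear condition, so some
    nonzero combination of two given eigenvectors satisfies it; hence at most one
    eigenvalue exceeds [c]. *)
Lemma lambda_star_le (R : realType) n (A : 'M[R]_n) (w : 'I_n -> R)
    (r : 'I_n) (c : R) :
  (forall i, 0 < w i) -> (forall i j, w i * A i j = w j * A j i) -> 0 <= c ->
  (forall f : 'rV_n, 0 <= wform w A f) ->
  (forall f : 'rV_n, f 0 r = 0 -> wform w A f <= c * wnorm w f) ->
  lambda_star A <= c.
Proof.
case: n A w r => [A w [] //|n] A w r w0 wA c0 A0 Ac.
have [Q [d [Qu dA normE formE]]] := reversible_diagonalization w0 wA.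
have [i0 [d_i0 ->]] := lambda_starE dA.
pose x a b i : 'rV[R]_n.+1 := a *: delta_mx 0 i + b *: delta_mx 0 i0.
have xE (G : 'I_n.+1 -> R) a b i : i != i0 ->
    \sum_j G j * x a b i 0 j ^+ 2 = G i * a ^+ 2 + G i0 * b ^+ 2.
  move=> ii0; rewrite (bigD1 i) //= (bigD1 i0) 1?eq_sym //= big1 => [|j /andP[ji ji0]].
    by rewrite !mxE !eqxx (negPf ii0) [i0 == i]eq_sym (negPf ii0) /=; ring.
  by rewrite !mxE (negPf ji) (negPf ji0) /= !mulr0 addr0 expr0n mulr0.
have normx a b i : i != i0 -> wnorm w (x a b i *m invmx Q) = a ^+ 2 + b ^+ 2.
  move=> ii0; rewrite normE mulmxKV //.
  have := xE (fun=> 1) a b i ii0; rewrite !mul1r => <-.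
  by apply: eq_bigr => j _; rewrite mul1r.
have formx a b i : i != i0 ->
    wform w A (x a b i *m invmx Q) = d 0 i * a ^+ 2 + d 0 i0 * b ^+ 2.
  by move=> ii0; rewrite formE mulmxKV // xE.
apply: bigmax_le => // i ii0.
have di0 : 0 <= d 0 i.
  by have := A0 (x 1 0 i *m invmx Q); rewrite formx // expr1n expr0n mulr1 mulr0 addr0.
rewrite ger0_norm //.
(* A nonzero combination of the eigenvectors of [i] and [i0] that vanishes at [r]. *)
have [a [b [ab ab0]]] : exists a b, 0 < a ^+ 2 + b ^+ 2 /\ (x a b i *m invmx Q) 0 r = 0.
  have xr a b : (x a b i *m invmx Q) 0 r = a * invmx Q i r + b * invmx Q i0 r.
    by rewrite mulmxDl -!scalemxAl -!rowE !mxE.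
  have [q0|q0] := eqVneq (invmx Q i r) 0.
    by exists 1, 0; rewrite xr q0; split; [lra | ring].
  exists (- invmx Q i0 r), (invmx Q i r); rewrite xr; split; last by ring.
  by rewrite sqrrN ltr_wpDl ?sqr_ge0 // exprn_even_gt0.
have := Ac _ ab0; rewrite normx // formx // => le_c.
rewrite -(ler_pM2r ab); apply: le_trans le_c; rewrite mulrDr lerD2l.
by rewrite ler_wpM2r ?sqr_ge0.
Qed.

(** The other half of Courant and Fischer: in the span of [g1] and [g2] some
    nonzero vector has no component along the top eigenvector. *)
Lemma lambda_star_ge (R : realType) n (A : 'M[R]_n) (w : 'I_n -> R)
    (c : R) (g1 g2 : 'rV[R]_n) :
  (forall i, 0 < w i) -> (forall i j, w i * A i j = w j * A j i) ->
  (forall a b, 0 < a ^+ 2 + b ^+ 2 -> 0 < wnorm w (a *: g1 + b *: g2)) ->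
  (forall a b, c * wnorm w (a *: g1 + b *: g2) <= wform w A (a *: g1 + b *: g2)) ->
  c <= lambda_star A.
Proof.
case: n A w g1 g2 => [A w g1 g2 _ _ g0 _|n A w g1 g2 w0 wA g0 gA].
  have : 0 < 0 :> R; last by rewrite ltxx.
  by have := g0 1 0; rewrite /wnorm big_ord0; apply; lra.
have [Q [d [Qu dA normE formE]]] := reversible_diagonalization w0 wA.
have [i0 [d_i0 ->]] := lambda_starE dA.
have [a [b [ab ab0]]] : exists a b, 0 < a ^+ 2 + b ^+ 2 /\
    ((a *: g1 + b *: g2) *m Q) 0 i0 = 0.
  have xr a b : ((a *: g1 + b *: g2) *m Q) 0 i0 =
      a * (g1 *m Q) 0 i0 + b * (g2 *m Q) 0 i0.
    by rewrite mulmxDl -!scalemxAl !mxE.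
  have [q0|q0] := eqVneq ((g1 *m Q) 0 i0) 0.
    by exists 1, 0; rewrite xr q0; split; [lra | ring].
  exists (- (g2 *m Q) 0 i0), ((g1 *m Q) 0 i0); rewrite xr; split; last by ring.
  by rewrite sqrrN ltr_wpDl ?sqr_ge0 // exprn_even_gt0.
rewrite -(ler_pM2r (g0 _ _ ab)); apply: le_trans (gA a b) _.
rewrite normE formE mulr_sumr; apply: ler_sum => i _.
have [->|ii0] := eqVneq i i0; first by rewrite ab0 expr0n !mulr0.
rewrite ler_wpM2r ?sqr_ge0 // (le_trans (ler_norm _)) //.
exact: (le_bigmax_cond _ (fun i => `|d 0 i|)).
Qed.

(** * Lazy simple random walk on a finite graph *)

(** Twice the Dirichlet energy: each edge is counted in both directions. *)
Definition energy (R : realType) (V : finType) (adj : rel V) (f : V -> R) : R :=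
  \sum_x \sum_(y | adj x y) (f x - f y) ^+ 2.

Definition mass (R : realType) (V : finType) (adj : rel V) (f : V -> R) : R :=
  \sum_x (degree adj x)%:R * f x ^+ 2.

Section LazyWalk.
Variables (R : realType) (V : finType) (adj : rel V).
Hypothesis adj_sym : symmetric adj.
Hypothesis degree_gt0 : forall x, (0 < degree adj x)%N.

Let w (i : 'I_#|V|) : R := (degree adj (enum_val i))%:R.
Let row_of (f : V -> R) : 'rV[R]_#|V| := \row_i f (enum_val i).

Lemma big_enum_val_all (F : V -> R) :
  \sum_(i < #|V|) F (enum_val i) = \sum_x F x.
Proof.
rewrite [RHS](reindex_onto enum_val enum_rank) => [|x _]; last exact: enum_rankK.
by apply: eq_bigl => i; rewrite enum_valK eqxx.
Qed.

Lemma mass_edges (f : V -> R) : mass adj f = \sum_x \sum_(y | adj x y) f x ^+ 2.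
Proof. by apply: eq_bigr => x _; rewrite sumr_const mulr_natl. Qed.

Lemma sum_edges_sym (F : V -> V -> R) :
  \sum_x \sum_(y | adj x y) F x y = \sum_x \sum_(y | adj x y) F y x.
Proof.
rewrite (exchange_big_dep predT) //=; apply: eq_bigr => x _.
by apply: eq_bigl => y; rewrite adj_sym.
Qed.

Lemma wnorm_mass f : wnorm w (row_of f) = mass adj f.
Proof.
by rewrite -[RHS]big_enum_val_all; apply: eq_bigr => i _; rewrite mxE.
Qed.

Lemma wform_lazy f :
  wform w (lazy_srw_mx R adj) (row_of f) =
  2^-1 * (mass adj f + \sum_x \sum_(y | adj x y) f x * f y).
Proof.
rewrite /mass -big_split -big_enum_val_all mulr_sumr; apply: eq_bigr => i _ /=.
have d0 : w i != 0 by rewrite pnatr_eq0 -lt0n.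
transitivity (\sum_j (2^-1 * (w i * f (enum_val i) * (f (enum_val j) *+ (i == j)))
   + 2^-1 * (if adj (enum_val i) (enum_val j)
             then f (enum_val i) * f (enum_val j) else 0))).
  apply: eq_bigr => j _; rewrite !mxE -/(w i); case: ifP => _.
    by case: eqP => _ /=; field.
  by case: eqP => _ /=; field.
rewrite big_split /= -!mulr_sumr -mulrDr; congr (_ * (_ + _)).
  rewrite (bigD1 i) //= eqxx big1 => [|j ji]; last by rewrite eq_sym (negPf ji).
  by rewrite mulr1n addr0 -mulrA -expr2.
rewrite mulr_sumr [RHS]big_mkcond -[RHS]big_enum_val_all.
by apply: eq_bigr => j _.
Qed.

Lemma sum_edges_add (f : V -> R) :
  \sum_x \sum_(y | adj x y) (f x + f y) ^+ 2 =
  2 * (mass adj f + \sum_x \sum_(y | adj x y) f x * f y).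
Proof.
transitivity (\sum_x \sum_(y | adj x y) f x ^+ 2
  + \sum_x \sum_(y | adj x y) f y ^+ 2 + 2 * \sum_x \sum_(y | adj x y) f x * f y).
  rewrite mulr_sumr -!big_split; apply: eq_bigr => x _ /=.
  by rewrite mulr_sumr -!big_split; apply: eq_bigr => y _ /=; ring.
by rewrite -(sum_edges_sym (fun x y => f x ^+ 2)) -mass_edges; ring.
Qed.

Lemma energyE (f : V -> R) :
  energy adj f = 2 * (mass adj f - \sum_x \sum_(y | adj x y) f x * f y).
Proof.
transitivity (\sum_x \sum_(y | adj x y) f x ^+ 2
  + \sum_x \sum_(y | adj x y) f y ^+ 2 - 2 * \sum_x \sum_(y | adj x y) f x * f y).
  rewrite mulr_sumr -sumrN -!big_split; apply: eq_bigr => x _ /=.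
  by rewrite mulr_sumr -sumrN -!big_split; apply: eq_bigr => y _ /=; ring.
by rewrite -(sum_edges_sym (fun x y => f x ^+ 2)) -mass_edges; ring.
Qed.

Lemma lazy_srw_reversible i j :
  w i * lazy_srw_mx R adj i j = w j * lazy_srw_mx R adj j i.
Proof.
have d0 k : w k != 0 by rewrite pnatr_eq0 -lt0n.
rewrite !mxE [adj (enum_val j) _]adj_sym -/(w i) -/(w j).
have := d0 i; have := d0 j; have [->//|_] := eqVneq i j.
case: ifP => _ dj di; last by rewrite mulr0n addr0 !mulr0.
by rewrite mulr0n !addr0 mulrCA [RHS]mulrCA !divff.
Qed.

Lemma row_ofE (g : 'rV[R]_#|V|) : g = row_of (fun x => g 0 (enum_rank x)).
Proof. by apply/matrixP => i j; rewrite ord1 mxE enum_valK. Qed.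

Lemma wform_gap f :
  wform w (lazy_srw_mx R adj) (row_of f) = mass adj f - energy adj f / 4.
Proof. by rewrite wform_lazy energyE; field. Qed.

Lemma w_gt0 i : 0 < w i. Proof. by rewrite ltr0n. Qed.

(** Laziness makes the form nonnegative, so that only the upper end of the
    spectrum matters for the absolute values in [lambda_star]. *)
Lemma lazy_lambda_star_le (r : V) (K : R) :
  1 <= K -> (forall f : V -> R, f r = 0 -> mass adj f <= K * energy adj f) ->
  lambda_star (lazy_srw_mx R adj) <= 1 - (4 * K)^-1.
Proof.
move=> K1 poincare.
have K0 : 0 < 4 * K by lra.
apply: (@lambda_star_le _ _ _ w (enum_rank r) _ w_gt0 lazy_srw_reversible) => [|g|g].
- by rewrite subr_ge0 invf_le1 //; lra.
- rewrite [g]row_ofE wform_lazy.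
  have : 0 <= \sum_x \sum_(y | adj x y) (g 0 (enum_rank x) + g 0 (enum_rank y)) ^+ 2.
    by apply: sumr_ge0 => x _; apply: sumr_ge0 => y _; apply: sqr_ge0.
  rewrite (sum_edges_add (fun x => g 0 (enum_rank x))); lra.
- move=> gr; rewrite [g]row_ofE wform_gap wnorm_mass.
  have := poincare (fun x => g 0 (enum_rank x)) gr.
  move: (mass _ _) (energy _ _) => M E ME.
  by rewrite mulrBl mul1r lerD2l lerN2 mulrC ler_pdivrMr //; lra.
Qed.

Lemma lazy_lambda_star_ge (g1 g2 : V -> R) (K : R) :
  (forall a b, 0 < a ^+ 2 + b ^+ 2 -> 0 < mass adj (fun x => a * g1 x + b * g2 x)) ->
  (forall a b, energy adj (fun x => a * g1 x + b * g2 x) <=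
               4 * K * mass adj (fun x => a * g1 x + b * g2 x)) ->
  1 - K <= lambda_star (lazy_srw_mx R adj).
Proof.
move=> g0 gK.
have gE a b : a *: row_of g1 + b *: row_of g2 = row_of (fun x => a * g1 x + b * g2 x).
  by apply/matrixP => i j; rewrite !mxE.
apply: (@lambda_star_ge _ _ _ w _ (row_of g1) (row_of g2) w_gt0
  lazy_srw_reversible) => a b.
  by rewrite gE wnorm_mass; apply: g0.
by rewrite gE wnorm_mass wform_gap; have := gK a b; lra.
Qed.

End LazyWalk.

(** * A Poincare inequality for binary heaps *)

(** In a heap rooted at 1 the parent of [a] is [a./2]: every vertex is the
    parent of exactly two. *)
Lemma sum_half (R : realType) (F : nat -> R) m n : (m <= n)%N ->
  \sum_(m.*2 <= a < n.*2) F a./2 = 2 * \sum_(m <= a < n) F a.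
Proof.
move=> /subnKC <-; elim: (n - m)%N => [|p IHp].
  by rewrite addn0 !big_geq ?mulr0.
rewrite addnS doubleS !big_nat_recr /=; try lia.
by rewrite IHp doubleK uphalf_double; ring.
Qed.

(** The Cauchy-Schwarz step from one level of a heap to the next: the first
    coefficient tends to 1 as [q], the number of vertices in the level, grows, so
    that the product of these coefficients over all levels stays bounded. *)
Lemma sqr_add_le (R : realType) (q x y : R) : 1 <= q ->
  (x + y) ^+ 2 <= (4 * q - 1) / (4 * q - 2) * x ^+ 2 + (4 * q - 1) * y ^+ 2.
Proof.
move=> q1; rewrite -subr_ge0.
have -> : (4 * q - 1) / (4 * q - 2) * x ^+ 2 + (4 * q - 1) * y ^+ 2 - (x + y) ^+ 2
  = (x - (4 * q - 2) * y) ^+ 2 / (4 * q - 2) by field; lra.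
by rewrite divr_ge0 ?sqr_ge0 //; lra.
Qed.

Section Heap.
Variables (R : realType) (f : nat -> R) (m : nat).

Let up a := (f a - f a./2) ^+ 2.
Let dev a := (f a - f 1%N) ^+ 2.
Let E d := \sum_(2 <= a < 2 ^ d.+1 | (a <= m)%N) up a.
Let level d := \sum_(2 ^ d <= a < 2 ^ d.+1 | (a <= m)%N) dev a.

Lemma heap_energyS d :
  E d.+1 = E d + \sum_(2 ^ d.+1 <= a < 2 ^ d.+2 | (a <= m)%N) up a.
Proof.
rewrite /E (@big_cat_nat _ _ _ (2 ^ d.+1)) //=.
  by rewrite expnS leq_pmulr ?expn_gt0.
by rewrite leq_exp2l.
Qed.

Lemma heap_energy_ge0 d : 0 <= E d.
Proof. by apply: sumr_ge0 => a _; apply: sqr_ge0. Qed.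

Lemma heap_levelS d (c : R) : 0 <= c ->
  \sum_(2 ^ d.+1 <= a < 2 ^ d.+2 | (a <= m)%N) c * dev a./2 <= 2 * c * level d.
Proof.
move=> c0; rewrite !expnS ![(2 * (2 * _))%N]mul2n !mul2n.
rewrite [leRHS](_ : _ =
    2 * \sum_(2 ^ d <= a < (2 ^ d).*2 | (a <= m)%N) c * dev a); last first.
  by rewrite -mulr_sumr /level expnS mul2n mulrA.
rewrite [\sum_(2 ^ d <= a < _ | _) _]big_mkcond -sum_half; last lia.
rewrite big_mkcond; apply: ler_sum => a _.
case: ifP => am; last by case: ifP => // _; rewrite mulr_ge0 ?sqr_ge0.
by rewrite (leq_trans _ am) // -{2}[a]odd_double_half -addnn; lia.
Qed.

(** Per vertex of a level the bound is a constant times the energy, which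
    is stronger than the bound on the sum; the constant increases from 1 towards
    2 with the depth, which leaves room for the factors of [sqr_add_le]. *)
Lemma heap_level d : level d <= (2 * 2 ^+ d - 1) * E d.
Proof.
elim: d => [|d IHd].
  rewrite /level expn1 expn0 big_ltn_cond // big_geq //= /dev subrr expr0n addr0 if_same.
  by rewrite mulr_ge0 ?heap_energy_ge0 // expr0; lra.
set q : R := 2 ^+ d in IHd *.
have q1 : 1 <= q by rewrite exprn_ege1 // ler1n.
pose c := (4 * q - 1) / (4 * q - 2).
have c0 : 0 <= c by rewrite divr_ge0 //; lra.
apply: (@le_trans _ _ (\sum_(2 ^ d.+1 <= a < 2 ^ d.+2 | (a <= m)%N)
    (c * dev a./2 + (4 * q - 1) * up a))).
  apply: ler_sum => a _; rewrite /dev /up.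
  by rewrite -[f a - f 1%N](subrKA (f a./2)) addrC; apply: sqr_add_le.
rewrite big_split /= -[X in _ + X <= _]mulr_sumr.
rewrite heap_energyS exprS -/q [leRHS](_ : _ = (4 * q - 1) * E d +
  (4 * q - 1) * \sum_(2 ^ d.+1 <= a < 2 ^ d.+2 | (a <= m)%N) up a); last by ring.
rewrite lerD2r (le_trans (heap_levelS _ c0)) //.
rewrite (le_trans (ler_wpM2l _ IHd)) //; first by rewrite mulr_ge0.
by rewrite le_eqVlt /c; apply/orP; left; apply/eqP; field; lra.
Qed.

Lemma heap_poincare : (0 < m)%N ->
  \sum_(1 <= a < m.+1) dev a <= 4 * m%:R * \sum_(2 <= a < m.+1) up a.
Proof.
move=> m0.
have main d : \sum_(1 <= a < 2 ^ d.+1 | (a <= m)%N) dev a <= 4 * 2 ^+ d * E d.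
  elim: d => [|d IHd].
    rewrite expn1 big_ltn_cond // big_geq //= /dev subrr expr0n addr0 if_same.
    by rewrite mulr_ge0 ?heap_energy_ge0 // expr0; lra.
  rewrite (@big_cat_nat _ _ _ (2 ^ d.+1)) ?expn_gt0 ?leq_exp2l //=.
  have := heap_level d.+1; have := heap_energy_ge0 d.+1.
  have : E d <= E d.+1.
    by rewrite heap_energyS lerDl; apply: sumr_ge0 => a _; apply: sqr_ge0.
  rewrite /level !exprS; move: IHd.
  set q := 2 ^+ d; have q1 : 1 <= q by rewrite exprn_ege1 // ler1n.
  move: (\sum_(_ <= _ < _ | _) _) (\sum_(_ <= _ < _ | _) _) (E _) (E _) => u v e e'.
  by nra.
pose h := trunc_log 2 m.
have /andP[hm mh] : (2 ^ h <= m < 2 ^ h.+1)%N by apply: trunc_log_bounds.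
have trunc (F : nat -> R) n :
    \sum_(n <= a < m.+1) F a = \sum_(n <= a < 2 ^ h.+1 | (a <= m)%N) F a.
  rewrite (big_nat_widen _ _ _ _ _ mh); apply: eq_bigl => a; by rewrite ltnS.
rewrite !trunc (le_trans (main h)) //; apply: ler_wpM2r; first exact: heap_energy_ge0.
by rewrite ler_pM2l ?ltr0n // -natrX ler_nat.
Qed.

End Heap.

(** * A Hardy inequality on the path *)

Lemma scale_gt0 j : (0 < scale j)%N.
Proof. by rewrite expn_gt0. Qed.

Lemma scaleS j : scale j.+1 = (scale j * scale j)%N.
Proof. by rewrite /scale expnS mul2n -addnn expnD. Qed.

Lemma scale_ge2 j : (2 <= scale j)%N.
Proof. by rewrite /scale -{1}(expn1 2) leq_exp2l // expn_gt0. Qed.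

Lemma double_scale_le j : (2 * scale j <= scale j.+1)%N.
Proof. by rewrite scaleS leq_mul2r scale_ge2 orbT. Qed.

Section Path.
Variables (R : realType) (h : nat -> R).

Let E a b := \sum_(a <= l < b) (h l.+1 - h l) ^+ 2.

Lemma path_energy_ge0 a b : 0 <= E a b.
Proof. by apply: sumr_ge0 => l _; apply: sqr_ge0. Qed.

Lemma path_energy_cat a b c : (a <= b)%N -> (b <= c)%N -> E a c = E a b + E b c.
Proof. by move=> ab bc; rewrite /E (@big_cat_nat _ _ _ b). Qed.

Lemma path_sqr_diff a b : (a <= b)%N -> (h b - h a) ^+ 2 <= (b - a)%:R * E a b.
Proof.
move=> /subnKC <-; rewrite addKn; elim: (b - a)%N => [|n IHn].
  by rewrite addn0 subrr expr0n mul0r.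
rewrite addnS (@path_energy_cat a (a + n)); try lia.
rewrite [E (a + n) _]big_nat1 -natr1.
rewrite -[h _.+1 - h a](subrKA (h (a + n)%N)).
move: IHn; have := path_energy_ge0 a (a + n).
move: (E _ _) (h _.+1 - h _) (h _ - h a) => e y x e0 xe.
case: n xe => [|n] xe; first by nra.
have : 0 <= (x - n.+1%:R * y) ^+ 2 by apply: sqr_ge0.
have : 0 < n.+1%:R :> R by rewrite ltr0n.
move: (n.+1%:R) xe => q xe q0 sq.
have : 0 <= e + q * y ^+ 2 - 2 * x * y; last by lra.
by rewrite -(pmulr_rge0 _ q0); nra.
Qed.

(** With [b_j] the summand, [b_j <= 3 E_j + 3/4 b_(j-1)] where [E_j] is the
    energy between two consecutive scales: the scales at least double, so that
    the old term is contracted and the sum telescopes into the total energy. *)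
Lemma path_hardy k : h 0%N = 0 ->
  \sum_(j < k.+1) h (scale j) ^+ 2 / (scale j)%:R <= 12 * E 0 (scale k).
Proof.
move=> h0; pose b j := h (scale j) ^+ 2 / (scale j)%:R.
have n0 j : 0 < (scale j)%:R :> R by rewrite ltr0n scale_gt0.
(* The term [3 * b k] pays for the contracted part of the next term. *)
suff : \sum_(j < k.+1) b j + 3 * b k <= 12 * E 0 (scale k).
  have : 0 <= b k by rewrite divr_ge0 ?sqr_ge0 ?ltW.
  by rewrite /b; lra.
elim: k => [|k IHk].
  have := path_sqr_diff (leq0n (scale 0)); have := path_energy_ge0 0 (scale 0).
  rewrite big_ord1 /b h0 subr0 subn0 /= => e0.
  by rewrite mulrC -ler_pdivrMr //; lra.
rewrite big_ord_recr /=.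
have kS := double_scale_le k; have kk := scale_gt0 k.
rewrite (@path_energy_cat 0 (scale k)) //; last lia.
have bS : b k.+1 <= 3 * E (scale k) (scale k.+1) + 3 / 4 * b k.
  rewrite /b ler_pdivrMr // -/(b k).
  set n : R := (scale k)%:R; set n' : R := (scale k.+1)%:R; set e := E (scale k) _.
  have nn' : 2 * n <= n' by rewrite -natrM ler_nat.
  have step : (h (scale k.+1) - h (scale k)) ^+ 2 <= n' * e.
    apply: le_trans (path_sqr_diff _) _; first by lia.
    by rewrite ler_wpM2r ?path_energy_ge0 // ler_nat leq_subr.
  have hk : h (scale k) ^+ 2 <= b k * n' / 2.
    have -> : h (scale k) ^+ 2 = b k * n by rewrite /b divfK // gt_eqF ?n0.
    have b0 : 0 <= b k by apply: divr_ge0; [exact: sqr_ge0 | exact: ltW].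
    by rewrite -mulrA ler_wpM2l //; lra.
  have sq : 0 <= (2 * h (scale k.+1) - 3 * h (scale k)) ^+ 2 by apply: sqr_ge0.
  by nra.
by lra.
Qed.

End Path.

(** * Coordinates on the tree *)

Lemma leq_scale i j : (i <= j)%N -> (scale i <= scale j)%N.
Proof. by move=> ij; rewrite !leq_exp2l. Qed.

Lemma scale_le_bigN k : (scale k <= bigN k)%N.
Proof. by rewrite /bigN expnS leq_pmulr // expn_gt0 scale_gt0. Qed.

Lemma bush_size0 k : bush_size k 0 = bigN k.
Proof. by []. Qed.

Lemma bush_size_gt0 k i : (0 < bush_size k i)%N.
Proof.
rewrite /bush_size; case: eqP => [_|i0]; first by rewrite expn_gt0 scale_gt0.
case: existsP => // -[j /andP[_ /eqP ->]].
rewrite divn_gt0 ?scale_gt0 // (leq_trans _ (scale_le_bigN k)) //.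
by rewrite leq_scale // -ltnS.
Qed.

Lemma bush_size_le k i : (bush_size k i <= bigN k)%N.
Proof.
rewrite /bush_size; case: eqP => // _; case: ifP => _; first exact: leq_div.
by rewrite expn_gt0 scale_gt0.
Qed.

(** A bush has [N / i] vertices if [i] is one of the scales that carry a tree,
    and a single vertex otherwise; the sum over all scales up to [k] and the
    last term dominate either case. *)
Lemma bush_size_weight (R : realType) k i (c : R) : (0 < i)%N -> 0 <= c ->
  (bush_size k i)%:R * c <=
    (bigN k)%:R * \sum_(j < k.+1) (if i == scale j then c / (scale j)%:R else 0) + c.
Proof.
move=> i0 c0.
have t0 (j : 'I_k.+1) : 0 <= (if i == scale j then c / (scale j)%:R else 0).
  by case: ifP => // _; rewrite divr_ge0.
rewrite /bush_size gtn_eqF //; case: existsP => [[j /andP[_ /eqP ij]]|_].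
  apply: ler_wpDr => //; rewrite (bigD1 j) //= ij eqxx mulrDr -ij.
  apply: ler_wpDr; first by rewrite mulr_ge0 // sumr_ge0.
  rewrite [leRHS]mulrCA [leLHS]mulrC ler_wpM2l //.
  rewrite ler_pdivlMr ?ltr0n // -natrM ler_nat; exact: leq_divM.
by rewrite mul1r lerDr mulr_ge0 // sumr_ge0.
Qed.

Section Coordinates.
Variable k : nat.
Local Notation V := (vertex k).

Definition path_pos (x : V) : nat := tag x.
Definition bush_pos (x : V) : nat := tagged x.

Lemma path_pos_le x : (path_pos x <= scale k)%N.
Proof. by rewrite -ltnS ltn_ord. Qed.

Lemma bush_pos_lt x : (bush_pos x < bush_size k (path_pos x))%N.
Proof. exact: ltn_ord. Qed.

Definition mk_vertex i a (hi : (i < (scale k).+1)%N) (ha : (a < bush_size k i)%N) : V :=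
  Tagged (fun i : 'I_(scale k).+1 => 'I_(bush_size k i))
    (Ordinal ha : 'I_(bush_size k (Ordinal hi))).

Lemma vertex_inj x y : path_pos x = path_pos y -> bush_pos x = bush_pos y -> x = y.
Proof.
case: x y => [i a] [j b]; rewrite /path_pos /bush_pos /= => /val_inj ij.
by case: j / ij b => b /val_inj ->.
Qed.

Lemma vertex_ex i a : (i <= scale k)%N -> (a < bush_size k i)%N ->
  exists x : V, path_pos x = i /\ bush_pos x = a.
Proof. by move=> hi ha; exists (mk_vertex (i := i) hi ha). Qed.

Definition tree_root : V := mk_vertex (ltn0Sn _) (bush_size_gt0 k 0).

Definition vertex_at (i a : nat) : V :=
  odflt tree_root [pick x | (path_pos x == i) && (bush_pos x == a)].

Lemma vertex_atK x : vertex_at (path_pos x) (bush_pos x) = x.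
Proof.
rewrite /vertex_at; case: pickP => [y /andP[/eqP yi /eqP ya]|/(_ x)] /=.
  exact: vertex_inj.
by rewrite !eqxx.
Qed.

Lemma sum_vertex (R : realType) (F : nat -> nat -> R) :
  \sum_(x : V) F (path_pos x) (bush_pos x) =
  \sum_(i < (scale k).+1) \sum_(a < bush_size k i) F i a.
Proof.
exact: esym (sig_big_dep predT (fun _ => predT)
  (fun (i : 'I_(scale k).+1) (a : 'I_(bush_size k i)) => F i a)).
Qed.

Definition tree_child (x y : V) : bool :=
  ((path_pos x == path_pos y) && bintree_child (bush_pos x) (bush_pos y))
  || [&& bush_pos x == 0%N, bush_pos y == 0%N & path_pos y == (path_pos x).+1].

Lemma tree_adjE x y : tree_adj x y = tree_child x y || tree_child y x.
Proof.
rewrite /tree_adj /tree_child -/(path_pos x) -/(path_pos y).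
rewrite -/(bush_pos x) -/(bush_pos y).
rewrite /bintree_adj [path_pos y == path_pos x]eq_sym; do ![case: eqP => //= _];
  by rewrite ?orbT ?orbF ?andbF //=; do ![case: bintree_child].
Qed.

Lemma tree_adj_sym : symmetric (@tree_adj k).
Proof. by move=> x y; rewrite !tree_adjE orbC. Qed.

Lemma tree_child_antisym x y : tree_child x y -> ~~ tree_child y x.
Proof. rewrite /tree_child /bintree_child; lia. Qed.

(** Every vertex except the root has exactly one parent. *)
Lemma sum_parents (R : realType) (G : nat -> nat -> nat -> nat -> R) y :
  \sum_(x | tree_child x y) G (path_pos x) (bush_pos x) (path_pos y) (bush_pos y) =
  if bush_pos y == 0%N then
    if path_pos y == 0%N then 0 else G (path_pos y).-1 0%N (path_pos y) 0%N
  else G (path_pos y) (bush_pos y).-1./2 (path_pos y) (bush_pos y).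
Proof.
have one p : tree_child p y -> (forall x, tree_child x y -> x = p) ->
    \sum_(x | tree_child x y) G (path_pos x) (bush_pos x) (path_pos y) (bush_pos y) =
    G (path_pos p) (bush_pos p) (path_pos y) (bush_pos y).
  move=> py pP; apply: big_pred1 => x; apply/idP/eqP => [/pP //|->//].
have yr := path_pos_le y; have yb := bush_pos_lt y.
case: eqP => [y0|/eqP y0].
  case: eqP => [i0|/eqP i0].
    apply: big_pred0 => x; rewrite /tree_child /bintree_child; lia.
  have [||p [pi pa]] := @vertex_ex (path_pos y).-1 0; [lia|exact: bush_size_gt0|].
  rewrite (one p) ?pi ?pa ?y0 //; first by rewrite /tree_child /bintree_child; lia.
  move=> x; rewrite /tree_child /bintree_child => xy.
  by apply: vertex_inj; lia.
have [||p [pi pa]] := @vertex_ex (path_pos y) (bush_pos y).-1./2; [lia|lia|].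
rewrite (one p) ?pi ?pa //; first by rewrite /tree_child /bintree_child; lia.
move=> x; rewrite /tree_child /bintree_child => xy.
by apply: vertex_inj; lia.
Qed.

End Coordinates.

(** * Energy, degrees and Poincare inequality on the tree *)

Section Tree.
Variables (R : realType) (k : nat).
Local Notation V := (vertex k).
Local Notation n := (scale k).
Local Notation N := (bigN k).
Local Notation adj := (@tree_adj k).

Definition path_energy (F : nat -> nat -> R) : R :=
  \sum_(0 <= l < n) (F l.+1 0%N - F l 0%N) ^+ 2.

Definition bush_energy (F : nat -> nat -> R) (i : nat) : R :=
  \sum_(1 <= a < bush_size k i) (F i a - F i a.-1./2) ^+ 2.

(** Each edge joins a vertex to its parent and is counted in both directions. *)
Lemma tree_energy F :
  energy adj (fun x => F (path_pos x) (bush_pos x)) =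
  2 * (path_energy F + \sum_(i < n.+1) bush_energy F i).
Proof.
pose G i a i' a' := (F i' a' - F i a) ^+ 2.
pose q (x y : V) := G (path_pos x) (bush_pos x) (path_pos y) (bush_pos y).
have qC x y : q x y = q y x by rewrite /q /G -sqrrN opprB.
transitivity (\sum_(x : V) \sum_y ((if tree_child x y then q x y else 0) +
    (if tree_child y x then q y x else 0))).
  apply: eq_bigr => x _; rewrite big_mkcond; apply: eq_bigr => y _.
  rewrite tree_adjE -/(q y x) [q y x]qC; have := @tree_child_antisym _ x y.
  case: (tree_child x y) => [/(_ isT)/negPf -> /=|_]; first by rewrite addr0.
  by case: (tree_child y x); rewrite ?addr0 ?add0r.
transitivity (2 * \sum_(y : V) \sum_(x | tree_child x y) q x y).
  under eq_bigr do rewrite big_split.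
  rewrite big_split mulr_natl mulr2n /=; congr (_ + _); [rewrite exchange_big|];
    by apply: eq_bigr => y _; rewrite [RHS]big_mkcond.
congr (_ * _).
under eq_bigr do rewrite sum_parents.
rewrite (@sum_vertex k R (fun i a => if a == 0%N then if i == 0%N then 0
   else G i.-1 0%N i 0%N else G i a.-1./2 i a)).
rewrite /path_energy -[X in X + _]add0r.
have -> : 0 + \sum_(0 <= l < n) (F l.+1 0%N - F l 0%N) ^+ 2 =
   \sum_(i < n.+1) (if i == 0%N :> nat then 0 else G i.-1 0%N i 0%N).
  by rewrite big_ord_recl big_mkord.
rewrite -big_split; apply: eq_bigr => i _ /=.
rewrite -(big_mkord predT (fun a => if a == 0%N then if i == 0%N :> nat then 0
   else G i.-1 0%N i 0%N else G i a.-1./2 i a)).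
rewrite big_ltn ?bush_size_gt0 //=; congr (_ + _).
by apply: eq_big_nat => -[|a].
Qed.

Lemma tree_degree_gt0 x : (0 < degree adj x)%N.
Proof.
suff [y xy] : exists y, adj x y by apply/card_gt0P; exists y.
have xr := path_pos_le x; have xb := bush_pos_lt x; have n0 := scale_gt0 k.
have [x0|x0] := eqVneq (bush_pos x) 0%N.
  have [i0|i0] := eqVneq (path_pos x) 0%N.
    have [||p [pi pa]] := @vertex_ex k 1 0; [lia|exact: bush_size_gt0|].
    by exists p; rewrite tree_adjE /tree_child; lia.
  have [||p [pi pa]] := @vertex_ex k (path_pos x).-1 0; [lia|exact: bush_size_gt0|].
  by exists p; rewrite tree_adjE /tree_child; lia.
have [||p [pi pa]] := @vertex_ex k (path_pos x) (bush_pos x).-1./2; [lia|lia|].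
exists p; rewrite tree_adjE /tree_child /bintree_child; lia.
Qed.

Lemma tree_degree_le x : (degree adj x <= 5)%N.
Proof.
pose c (y : V) := (path_pos y, bush_pos y).
have c_inj : injective c by move=> y z [yi ya]; apply: vertex_inj.
pose i := path_pos x; pose a := bush_pos x.
(* The children and the parent in the bush, and the neighbours on the path. *)
pose s := [:: (i, a.*2.+1); (i, a.*2.+2); (i, a.-1./2); (i.+1, 0%N); (i.-1, 0%N)].
rewrite /degree -[5%N]/(size s) cardE -(size_map c).
apply: uniq_leq_size; first by rewrite map_inj_uniq ?enum_uniq.
move=> p /mapP[y]; rewrite mem_enum inE tree_adjE => xy ->{p}.
move: xy; rewrite /tree_child /bintree_child /c !inE !xpair_eqE -/i -/a; lia.
Qed.

(** [heap_poincare] for the bush with its numbering shifted to start at 1. *)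
Lemma bush_deviation (F : nat -> nat -> R) i :
  \sum_(a < bush_size k i) (F i a - F i 0%N) ^+ 2 <=
  4 * N%:R * bush_energy F i.
Proof.
have := heap_poincare (fun b => F i b.-1) (bush_size_gt0 k i).
rewrite [leLHS]big_add1 [X in _ <= _ * X]big_add1 /= big_mkord => dev_le.
apply: le_trans dev_le _.
rewrite (_ : \sum_(1 <= a < _) _ = bush_energy F i).
  rewrite ler_wpM2r ?ler_pM2l ?ler_nat ?bush_size_le //.
  by apply: sumr_ge0 => a _; apply: sqr_ge0.
by apply: eq_big_nat => -[|a].
Qed.

(** Of the two terms of [bush_size_weight], the first is controlled by
    [path_hardy]; in the second each value is at most [n_k] times the energy, and
    there are [n_k] of them, with [n_k * n_k <= N]. *)
Lemma weighted_path (F : nat -> nat -> R) : F 0%N 0%N = 0 ->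
  \sum_(i < n.+1) (bush_size k i)%:R * F i 0%N ^+ 2 <= 13 * N%:R * path_energy F.
Proof.
move=> F0; pose h i := F i 0%N.
have P0 : 0 <= path_energy F by apply: sumr_ge0 => l _; apply: sqr_ge0.
have hle i : (i <= n)%N -> h i ^+ 2 <= n%:R * path_energy F.
  move=> i_n; have := path_sqr_diff h (leq0n i).
  rewrite [h 0%N]F0 subr0 subn0 => hi; apply: le_trans hi _.
  apply: ler_pM => //; first by apply: path_energy_ge0.
    by rewrite ler_nat.
  by rewrite /path_energy (@path_energy_cat _ h 0 i n) // lerDl path_energy_ge0.
rewrite big_ord_recl F0 expr0n mulr0 add0r.
apply: (@le_trans _ _ (\sum_(i < n) (N%:R * \sum_(j < k.+1)
   (if i.+1 == scale j then h i.+1 ^+ 2 / (scale j)%:R else 0) + n%:R * path_energy F))).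
  apply: ler_sum => i _; apply: le_trans (bush_size_weight _ _ _) _ => //.
    exact: sqr_ge0.
  by rewrite lerD2l; apply: hle; apply: (ltn_ord i).
rewrite big_split /= -mulr_sumr sumr_const card_ord exchange_big /=.
have -> : \sum_(j < k.+1) \sum_(i < n)
    (if i.+1 == scale j then h i.+1 ^+ 2 / (scale j)%:R else 0) =
    \sum_(j < k.+1) h (scale j) ^+ 2 / (scale j)%:R.
  apply: eq_bigr => j _; have j0 := scale_gt0 j.
  have jk : (scale j <= n)%N by rewrite leq_scale // -ltnS.
  have jn : ((scale j).-1 < n)%N by lia.
  rewrite (bigD1 (Ordinal jn)) //= prednK // eqxx big1 ?addr0 // => i ij.
  case: eqP => // ijs; case/eqP: ij; apply: val_inj => /=; lia.
have hardy := @path_hardy R h k F0.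
have nN : (n * n)%:R <= N%:R :> R.
  by rewrite ler_nat /bigN !expnS expn0 muln1 leq_mul // leq_pmulr // scale_gt0.
apply: (@le_trans _ _ (N%:R * (12 * path_energy F) + N%:R * path_energy F)).
  apply: lerD; first by apply: ler_wpM2l; [exact: ler0n | exact: hardy].
  by rewrite -[_ *+ n]mulr_natl mulrA -natrM ler_wpM2r.
by rewrite le_eqVlt; apply/orP; left; apply/eqP; ring.
Qed.

(** The constant is [5 * 26 / 2]: degrees are at most 5, splitting off the bush
    root doubles the factors 4 and 13, and the energy counts edges twice. *)
Lemma tree_poincare (f : V -> R) : f (tree_root k) = 0 ->
  mass adj f <= 65 * N%:R * energy adj f.
Proof.
move=> f0; pose F i a := f (vertex_at k i a).
have fE : f =1 fun x => F (path_pos x) (bush_pos x).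
  by move=> x; rewrite /F vertex_atK.
have F0 : F 0%N 0%N = 0 by rewrite /F -f0 -[in RHS](vertex_atK (tree_root k)).
have -> : energy adj f = energy adj (fun x : V => F (path_pos x) (bush_pos x)).
  by apply: eq_bigr => x _; apply: eq_bigr => y _; rewrite !fE.
have -> : mass adj f = mass adj (fun x : V => F (path_pos x) (bush_pos x)).
  by apply: eq_bigr => x _; rewrite fE.
rewrite tree_energy.
apply: (@le_trans _ _ (5 * \sum_(x : V) F (path_pos x) (bush_pos x) ^+ 2)).
  rewrite mulr_sumr; apply: ler_sum => x _.
  by rewrite ler_wpM2r ?sqr_ge0 // (ler_nat R _ 5) tree_degree_le.
rewrite (@sum_vertex k R (fun i a => F i a ^+ 2)).
have : \sum_(i < n.+1) \sum_(a < bush_size k i) F i a ^+ 2 <=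
    \sum_(i < n.+1) (2 * (4 * N%:R * bush_energy F i) +
                     2 * ((bush_size k i)%:R * F i 0%N ^+ 2)).
  apply: ler_sum => i _.
  apply: (@le_trans _ _ (\sum_(a < bush_size k i)
      (2 * (F i a - F i 0%N) ^+ 2 + 2 * F i 0%N ^+ 2))).
    apply: ler_sum => a _.
    by have := sqr_ge0 (F i a - 2 * F i 0%N); lra.
  rewrite big_split -!mulr_sumr sumr_const card_ord /= -mulr_natl.
  by have := bush_deviation F i; lra.
rewrite big_split -!mulr_sumr /=.
have := weighted_path F0.
have : 0 <= \sum_(i < n.+1) bush_energy F i.
  by apply: sumr_ge0 => i _; apply: sumr_ge0 => a _; apply: sqr_ge0.
have : 0 <= N%:R :> R by [].
move: (\sum_(i < n.+1) bush_energy F i) (path_energy F) (N%:R).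
move: (\sum_(i < n.+1) (_ * _)) (\sum_(i < n.+1) \sum_(a < _) _) => u v b p m; nra.
Qed.

End Tree.

(** * Two bottlenecks and the relaxation time *)

(** The two leading binary digits: in the heap numbering from 1 they tell which
    child of the root a vertex descends from, as [2] or [3]. *)
Definition top2 (b : nat) : nat := (b %/ 2 ^ (trunc_log 2 b).-1)%N.

Lemma top2_half b : (4 <= b)%N -> top2 b./2 = top2 b.
Proof.
move=> b4; rewrite /top2 (@trunc_log2S b); last by lia.
have : (0 < trunc_log 2 b./2)%N by rewrite trunc_log_gt0 /=; lia.
by case: (trunc_log 2 b./2) => // t _ /=; rewrite expnS divnMA divn2.
Qed.

Lemma top2_eq c t b : (2 <= c < 4)%N ->
  (c * 2 ^ t <= b < c.+1 * 2 ^ t)%N -> top2 b = c.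
Proof.
move=> /andP[c2 c4] /andP[lo hi]; have t0 : (0 < 2 ^ t)%N by rewrite expn_gt0.
rewrite /top2 (@trunc_log_eq 2 t.+1) //=; last by rewrite !expnS; nia.
by apply/eqP; rewrite eqn_leq -ltnS ltn_divLR // hi leq_divRL.
Qed.

Section Cut.
Variables (R : realType) (k : nat) (alpha beta : R).
Local Notation V := (vertex k).
Local Notation N := (bigN k).

Definition cut (b : nat) : R :=
  alpha * (top2 b == 2)%:R + beta * (top2 b == 3)%:R.

Definition tree_cut (i a : nat) : R := if i == 0%N then cut a.+1 else 0.

(** That [N] is a power of two makes all the levels of its bush complete up to
    one vertex. *)
Lemma bigN_pow2 : exists t, N = (4 * 2 ^ t)%N.
Proof.
exists (2 ^ k * 3 - 2)%N; rewrite /bigN /scale -expnM -(expnD 2 2) subnKC //.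
by rewrite (leq_trans _ (leq_mul (expn_gt0 2 k) (leqnn 3))).
Qed.

(** Only the edges from the root to its two children are cut. *)
Lemma cut_energy :
  energy (@tree_adj k) (fun x => tree_cut (path_pos x) (bush_pos x)) =
  2 * (alpha ^+ 2 + beta ^+ 2).
Proof.
have [t NE] := bigN_pow2; have t0 : (0 < 2 ^ t)%N by rewrite expn_gt0.
have c1 : cut 1 = 0 by rewrite /cut /top2 /= !mulr0 addr0.
have c2 : cut 2 = alpha by rewrite /cut /top2 /= mulr1 mulr0 addr0.
have c3 : cut 3 = beta by rewrite /cut /top2 /= mulr1 mulr0 add0r.
rewrite tree_energy; congr (_ * _).
rewrite /path_energy big1 ?add0r => [|l _]; last first.
  by rewrite /tree_cut /=; case: eqP => _; rewrite ?c1 subrr expr0n.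
rewrite big_ord_recl [X in _ + X]big1 ?addr0 => [|i _]; last first.
  by rewrite /bush_energy big1 // => a _; rewrite /tree_cut /= subrr expr0n.
rewrite /bush_energy /tree_cut /= bush_size0.
rewrite big_ltn; last by lia.
rewrite big_ltn; last by lia.
rewrite /= c1 c2 c3 !subr0 big_nat_cond big1 ?addr0 // => a /andP[/andP[a3 _] _].
have -> : a.-1./2.+1 = a.+1./2 by lia.
by rewrite /cut top2_half ?subrr ?expr0n //; lia.
Qed.

(** The last complete level alone has [N / 4] vertices on each side. *)
Lemma cut_mass :
  N%:R / 4 * (alpha ^+ 2 + beta ^+ 2) <=
  mass (@tree_adj k) (fun x => tree_cut (path_pos x) (bush_pos x)).
Proof.
have [t NE] := bigN_pow2; have t0 : (0 < 2 ^ t)%N by rewrite expn_gt0.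
have sq0 b : 0 <= cut b ^+ 2 by apply: sqr_ge0.
apply: (@le_trans _ _ (\sum_(x : V) tree_cut (path_pos x) (bush_pos x) ^+ 2)); last first.
  apply: ler_sum => x _; rewrite -[leLHS]mul1r ler_wpM2r ?sqr_ge0 //.
  by rewrite (ler_nat R 1) tree_degree_gt0.
rewrite (@sum_vertex k R (fun i a => tree_cut i a ^+ 2)) big_ord_recl ler_wpDr //.
  by apply: sumr_ge0 => i _; apply: sumr_ge0 => a _; apply: sqr_ge0.
rewrite [ord0 : nat]/= bush_size0 -(big_mkord predT (fun a => cut a.+1 ^+ 2)).
rewrite -(big_add1 _ _ 0 N.+1 predT (fun b => cut b ^+ 2)).
have const c (v : R) : (2 <= c < 4)%N ->
    (forall b, top2 b = c -> cut b = v) ->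
    \sum_(c * 2 ^ t <= b < c.+1 * 2 ^ t) cut b ^+ 2 = (2 ^ t)%:R * v ^+ 2.
  move=> c24 cv; transitivity (\sum_(c * 2 ^ t <= b < c.+1 * 2 ^ t) v ^+ 2).
    by apply: eq_big_nat => b hb; rewrite (cv b) // (top2_eq c24 hb).
  by rewrite sumr_const_nat mulSn addnK mulr_natl.
rewrite (@big_cat_nat _ _ _ (2 * 2 ^ t)) //=; [|nia|lia].
rewrite (@big_cat_nat _ _ _ (3 * 2 ^ t) (2 * 2 ^ t)) //=; [|nia|lia].
rewrite (@big_cat_nat _ _ _ (4 * 2 ^ t) (3 * 2 ^ t)) //=; [|nia|lia].
rewrite (const 2 alpha) // => [|b b2]; last by rewrite /cut b2 mulr1 mulr0 addr0.
rewrite (const 3 beta) // => [|b b3]; last by rewrite /cut b3 mulr1 mulr0 add0r.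
rewrite NE (_ : (4 * 2 ^ t)%:R / 4 = (2 ^ t)%:R :> R); last by rewrite natrM; field.
rewrite mulrDr.
set u := \sum_(_ <= _ < _) _; set v := \sum_(_ <= _ < _) _.
have u0 : 0 <= u by apply: sumr_ge0.
have v0 : 0 <= v by apply: sumr_ge0.
lra.
Qed.

End Cut.

Lemma tree_lambda_star_le (R : realType) k :
  lambda_star (lazy_srw_mx R (@tree_adj k)) <= 1 - (260 * (bigN k)%:R)^-1.
Proof.
have N1 : 1 <= (bigN k)%:R :> R by rewrite (ler_nat R 1) expn_gt0 scale_gt0.
have -> : 260 * (bigN k)%:R = 4 * (65 * (bigN k)%:R) :> R by ring.
apply: (@lazy_lambda_star_le _ _ _ (@tree_adj_sym k) (@tree_degree_gt0 k) (tree_root k)).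
  by lra.
exact: tree_poincare.
Qed.

Lemma tree_lambda_star_ge (R : realType) k :
  1 - 2 / (bigN k)%:R <= lambda_star (lazy_srw_mx R (@tree_adj k)).
Proof.
have N1 : 0 < (bigN k)%:R :> R by rewrite ltr0n expn_gt0 scale_gt0.
pose g1 (x : vertex k) : R := tree_cut 1 0 (path_pos x) (bush_pos x).
pose g2 (x : vertex k) : R := tree_cut 0 1 (path_pos x) (bush_pos x).
have gE a b : (fun x => a * g1 x + b * g2 x) =1
    fun x => tree_cut a b (path_pos x) (bush_pos x).
  by move=> x; rewrite /g1 /g2 /tree_cut /cut; case: eqP => _; ring.
have gM a b : mass (@tree_adj k) (fun x => a * g1 x + b * g2 x) =
    mass (@tree_adj k) (fun x => tree_cut a b (path_pos x) (bush_pos x)).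
  by apply: eq_bigr => x _; rewrite gE.
have gEn a b : energy (@tree_adj k) (fun x => a * g1 x + b * g2 x) =
    2 * (a ^+ 2 + b ^+ 2).
  by rewrite -(cut_energy k); apply: eq_bigr => x _; apply: eq_bigr => y _; rewrite !gE.
apply: (@lazy_lambda_star_ge _ _ _ (@tree_adj_sym k) (@tree_degree_gt0 k) g1 g2) => a b.
  move=> ab; rewrite gM; apply: lt_le_trans (cut_mass k a b).
  by rewrite mulr_gt0 // divr_gt0.
rewrite gM gEn; have := cut_mass k a b; move: (mass _ _) (a ^+ 2 + b ^+ 2) => M s sM.
have -> : 4 * (2 / (bigN k)%:R) * M = 8 * M / (bigN k)%:R by field; lra.
rewrite ler_pdivlMr //; lra.
Qed.

Theorem theorem1p3 (R : realType) :
  exists C : R, 0 < C /\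
    forall k : nat, (1 <= k)%N ->
      C^-1 * (bigN k)%:R <= t_rel R k /\ t_rel R k <= C * (bigN k)%:R.
Proof.
exists 260; split=> [//|k _].
have N0 : 0 < (bigN k)%:R :> R by rewrite ltr0n expn_gt0 scale_gt0.
have le := tree_lambda_star_le R k; have ge := tree_lambda_star_ge R k.
have C0 : 0 < 260 * (bigN k)%:R :> R by rewrite mulr_gt0.
rewrite /t_rel /relaxation_time; move: (lambda_star _) le ge => l le ge.
have i0 : 0 < (260 * (bigN k)%:R)^-1 :> R by rewrite invr_gt0.
have l1 : 0 < 1 - l by lra.
split; last by rewrite -[leRHS]invrK lef_pV2 ?posrE //; lra.
apply: (@le_trans _ _ ((2 / (bigN k)%:R)^-1)).
  by rewrite invf_div mulrC; lra.
by rewrite lef_pV2 ?posrE ?divr_gt0 //; lra.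
Qed.
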